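(* Let $F$ be a finitely generated group with infinitely many ends. Then $F$ does not allow a left-invariant ordering with a finitely generated positive cone.
   Context: A left-invariant ordering on a group $F$ is a total (linear) order $<$ on $F$ such that $a < b$ implies $ca < cb$ for all $a,b,c \in F$. Its positive cone is $P = \{g \in F \mid 1 < g\}$. Equivalently, positive cones of left-invariant orderings are exactly the subsets $P \subset F$ closed under multiplication such that $F$ is the disjoint union $F = \{1\} \sqcup P \sqcup P^{-1}$, where $P^{-1} = \{p^{-1} \mid p \in P\}$. A positive cone is finitely generated if it is finitely generated as a semigroup. The number of ends of a finitely generated group is the number of ends of its Cayley graph with respect to any finite generating set. *)

(* Defs.v *)
From HB Require Import structures.
From mathcomp Require Import all_boot.
From mathcomp Require Import finmap boolp classical_sets cardinality.

Set Implicit Arguments.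
Unset Strict Implicit.
Unset Printing Implicit Defensive.

Local Open Scope classical_set_scope.
Local Open Scope group_scope.

(* The Cayley graph has the elements of F as vertices and an undirected edge
   between g and g * s for every g in F and s in S. *)
Definition cayley_graph (F : groupType) (S : {fset F}) : rel F :=
  fun g h => (g^-1 * h \in S) || (h^-1 * g \in S).

Section GraphEnds.
Variables (V : choiceType) (e : rel V).

Definition connected_off (K : {fset V}) (x y : V) : Prop :=
  exists p : seq V,
    [/\ path e x p, last x p = y & all (fun z => z \notin K) (x :: p)].

Definition component_off (K : {fset V}) (C : set V) : Prop :=
  exists2 x, x \notin K & C = [set y | connected_off K x y].

(* An end of a locally finite graph is an element of the inverse limit, over the
   finite vertex sets K ordered by inclusion, of the sets of connected
   components of the graph minus K.  Coherence forces every chosen component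
   to be infinite: E K cannot be contained in a finite set K' since
   E (K `|` K') is nonempty, contained in E K and disjoint from K'. *)
Definition graph_ends : set ({fset V} -> set V) :=
  [set E | (forall K, component_off K (E K)) /\
           (forall K L : {fset V}, (K `<=` L)%fset -> E L `<=` E K)].

End GraphEnds.

Section Orderings.
Variable F : groupType.

Definition subgroup_generated (A : set F) : set F :=
  smallest (fun H : set F => group_closed (mem H)) A.

Definition subsemigroup_generated (A : set F) : set F :=
  smallest (fun H : set F => mulg_closed (mem H)) A.

Definition generates_group (S : {fset F}) : Prop :=
  subgroup_generated [set` S] = setT.

Definition fg_semigroup (P : set F) : Prop :=
  exists A : {fset F}, P = subsemigroup_generated [set` A].

Definition left_invariant_ordering (lt : rel F) : Prop :=
  [/\ irreflexive lt,
      transitive lt,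
      forall a b, a != b -> lt a b || lt b a
    & forall a b c, lt a b -> lt (c * a) (c * b)].

Definition positive_cone (lt : rel F) : set F := [set g | lt 1 g].

End Orderings.

(* Main.v *)
Require Import Defs.
From mathcomp Require Import all_boot.
From mathcomp Require Import finmap boolp classical_sets cardinality.

Set Implicit Arguments.
Unset Strict Implicit.
Unset Printing Implicit Defensive.

Local Open Scope classical_set_scope.
Local Open Scope group_scope.

(** A finitely generated positive cone forces at most two ends, by the following
    argument.

    Let K be a finite set of vertices. If M is large enough then multiplying an
    element x > M by a generator a of the positive cone follows a path from x to
    x * a that misses K; since x < y means that y is x times a product of such
    generators, all elements above M lie in one component off K
    ([upper_set_connected]). Hence, among three infinite components off K, two,
    say D1 and D2, are low: they have no element above M. This is impossible
    ([no_two_low_components]).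

    Indeed, enclose K and M in a finite connected set L. An infinite component
    D contains a translate g L disjoint from L. If D is low, g M < M, and g maps
    all of D into D ([attracting_translate]): off g K, the connected set L is
    joined to M > g M, so it does not meet the low component g D; thus g D
    avoids K, and it is adjacent to g K, which lies in D. So g contracts D, and
    g^n y < M for every y and some n, which means that the points g^-n M are
    cofinal in the order ([iter_cofinal]).

    Take g for D1 and h for D2 in this way, and a finite path W from M to
    g^-1 M. The translates g^-n W form a ray from M that exceeds any bound. For
    each n, the component h^-n D2 off h^-n K contains M and is bounded above by
    h^-n M, so this ray has to leave it and hits h^-n K. Thus for each n some
    h^n g^-i lies in the finite set K W^-1. By the pigeonhole principle a
    positive power of h is a power g^c of g. For c > 0 it maps M into both D1
    and D2; for c <= 0 it moves M both down and not down. In the language of ends: the upper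
    end is fixed by the whole group, and two contracting elements with a common
    repelling end in a proper action share a power. *)

(** * Paths and components in graphs *)

Lemma pigeonhole (T : eqType) (s : seq T) (f : nat -> T) :
  (forall n, f n \in s) -> exists i j, (i < j)%N /\ f i = f j.
Proof.
move=> fs; set t := mkseq f (size s).+1.
have : ~~ uniq t.
  apply/negP => /uniq_leq_size/(_ _)/negP.
  have ts : {subset t <= s} by move=> x /mapP[n _ ->].
  by move=> /(_ s ts); rewrite size_mkseq ltnn.
case/(uniqPn (f 0)) => i [j [ij]]; rewrite size_mkseq => js.
by rewrite !nth_mkseq ?(ltn_trans ij js)// => fij; exists i, j.
Qed.

Section Reach.
Variables (V : choiceType) (e : rel V).
Implicit Types (A B D : set V) (x y z : V).

(** Paths inside an arbitrary set of vertices, in inductive form, so that facts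
    about paths are proved one edge at a time and the set can be translated. *)
Inductive reach A x : V -> Prop :=
| reach_refl : A x -> reach A x x
| reach_step y z : reach A x y -> e y z -> A z -> reach A x z.

Lemma reach_target A x y : reach A x y -> A y.
Proof. by case. Qed.

Lemma reach_source A x y : reach A x y -> A x.
Proof. by elim. Qed.

Lemma reach_trans A x y z : reach A x y -> reach A y z -> reach A x z.
Proof.
by move=> xy; elim=> // u v _ xu uv Av; apply: reach_step uv Av.
Qed.

Lemma reach_sym A x y : symmetric e -> reach A x y -> reach A y x.
Proof.
move=> esym; elim=> [|u v xu ux uv Av]; first exact: reach_refl.
apply: reach_trans ux; apply: reach_step (reach_refl Av) _ (reach_target xu).
by rewrite esym.
Qed.

Lemma reach_mono A B x y : A `<=` B -> reach A x y -> reach B x y.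
Proof.
move=> AB; elim=> [/AB|u v _ xu uv /AB]; first exact: reach_refl.
exact: reach_step xu uv.
Qed.

(** The vertices of a path; every one of them, not just the endpoint, is reached
    inside the list, which makes these lists the building blocks of finite
    connected sets. *)
Lemma reach_finite A x y : reach A x y -> exists s : seq V,
  [/\ y \in s, {in s, forall z, A z} & {in s, forall z, reach [set` s] x z}].
Proof.
elim=> [Ax|u v _ [s [us sA xs]] uv Av].
  exists [:: x]; rewrite inE eqxx; split=> // z; rewrite inE => /eqP-> //.
  by apply: reach_refl; rewrite /= inE.
have sub : [set` s] `<=` [set` v :: s] by move=> z /= zs; rewrite inE zs orbT.
exists (v :: s); rewrite inE eqxx; split=> // z; rewrite inE.
  by move=> /predU1P[->|/sA].
move=> /predU1P[->|/xs]; last exact: reach_mono.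
by apply: reach_step (reach_mono sub (xs _ us)) uv _; rewrite /= inE eqxx.
Qed.

(** The edge by which a path first leaves D. *)
Lemma reach_exit A D x y : reach A x y -> D x -> ~ D y ->
  exists u v, [/\ reach D x u, e u v, A v & ~ D v].
Proof.
move=> xy Dx nDy.
suff : reach D x y \/ exists u v, [/\ reach D x u, e u v, A v & ~ D v].
  by case=> // /reach_target /nDy.
elim: xy {nDy} => [_|u v _ [xu|] uv Av]; [by left; apply: reach_refl| |by right].
have [Dv|nDv] := EM (D v); first by left; apply: reach_step uv Dv.
by right; exists u, v.
Qed.

Lemma connected_offE (K : {fset V}) x y :
  connected_off e K x y <-> reach (~` [set` K]) x y.
Proof.
split=> [[p [xp <- {y}]]|].
  elim/last_ind: p xp => [_ /=|p z IH].
    by rewrite andbT => /negP; apply: reach_refl.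
  rewrite rcons_path -rcons_cons all_rcons last_rcons.
  move=> /andP[xp pz] /andP[/negP zK pK].
  by apply: reach_step (IH xp pK) pz zK.
elim=> [xK|u v _ [p [xp <- pK]] uv vK].
  by exists [::]; split=> //=; rewrite andbT; apply/negP.
exists (rcons p v); split; rewrite ?last_rcons ?rcons_path ?xp//.
by rewrite -rcons_cons all_rcons pK andbT; apply/negP.
Qed.

(** A component off K (or the empty set), described without choosing a base
    vertex. *)
Record component (K D : set V) : Prop := Component {
  component_disjoint : D `<=` ~` K;
  component_reach : forall x y, D x -> D y -> reach (~` K) x y;
  component_closed : forall x y, D x -> reach (~` K) x y -> D y }.

Lemma component_offP (K : {fset V}) D : symmetric e ->
  component_off e K D -> component [set` K] D.
Proof.
move=> esym [x _ ->]; split=> [y|y z|y z] /=.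
- by move/connected_offE/reach_target.
- move=> /connected_offE xy /connected_offE; apply: reach_trans.
  exact: reach_sym.
- by move=> /connected_offE xy yz; apply/connected_offE/(reach_trans xy).
Qed.

Lemma component_eq K D D' x :
  component K D -> component K D' -> D x -> D' x -> D = D'.
Proof.
move=> cD cD' Dx D'x; apply/seteqP; split=> y.
- by move=> /(component_reach cD Dx)/(component_closed cD' D'x).
- by move=> /(component_reach cD' D'x)/(component_closed cD Dx).
Qed.

Lemma component_neighbor K D x y :
  component K D -> D x -> e x y -> ~ K y -> D y.
Proof.
move=> cD Dx xy nKy; apply: (component_closed cD Dx).
exact: reach_step (reach_refl (component_disjoint cD Dx)) xy nKy.
Qed.

Lemma connected_finite_superset x (s : seq V) :
  (forall y, reach setT x y) ->
  exists t : seq V, [/\ x \in t, {subset s <= t} &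
    forall y, y \in t -> reach [set` t] x y].
Proof.
move=> conn; elim: s => [|y s [t [xt st tr]]].
  exists [:: x]; rewrite inE eqxx; split=> // y; rewrite inE => /eqP->.
  by apply: reach_refl; rewrite /= inE.
have [p [yp _ xp]] := reach_finite (conn y).
have subt : [set` t] `<=` [set` p ++ t].
  by move=> z /= zt; rewrite mem_cat zt orbT.
exists (p ++ t); split=> [|z|z].
- exact: subt.
- rewrite inE => /predU1P[->|/st]; last exact: subt.
  by rewrite mem_cat yp.
- rewrite mem_cat => /orP[/xp|/tr]; last exact: reach_mono.
  by apply: reach_mono => w /= wp; rewrite mem_cat wp.
Qed.
End Reach.

(** * Generated subgroups and Cayley graphs *)

Section Generated.
Variables (F : groupType) (A : {fset F}) (Q : F -> Prop).
Hypothesis QA : forall a, a \in A -> Q a.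

Lemma subgroup_generated_ind :
    Q 1 -> (forall u v, Q u -> Q v -> Q (u * v^-1)) ->
  forall g, subgroup_generated [set` A] g -> Q g.
Proof.
move=> Q1 QV g; apply: (@smallest_sub _ _ _ [set h | Q h]) => //.
by split=> [|u v]; rewrite !in_setE; [|apply: QV].
Qed.

Lemma subsemigroup_generated_ind :
    (forall u v, Q u -> Q v -> Q (u * v)) ->
  forall g, subsemigroup_generated [set` A] g -> Q g.
Proof.
move=> QM g; apply: (@smallest_sub _ _ _ [set h | Q h]) => //.
by move=> u v; rewrite !in_setE; apply: QM.
Qed.
End Generated.

Section CayleyGraph.
Variables (F : groupType) (S : {fset F}).
Local Notation e := (cayley_graph S).
Implicit Types (A B : set F) (g h x y : F).

Lemma cayley_graph_sym : symmetric e.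
Proof. by move=> x y; rewrite /cayley_graph orbC. Qed.

Lemma cayley_graph_mul g x y : e (g * x) (g * y) = e x y.
Proof. by rewrite /cayley_graph !invgM -!mulgA !mulKg. Qed.

Lemma reach_mul g A B x y : (forall z, A z -> B (g * z)) ->
  reach e A x y -> reach e B (g * x) (g * y).
Proof.
move=> AB; elim=> [/AB|u v _ xu uv /AB]; first exact: reach_refl.
by apply: reach_step xu _; rewrite cayley_graph_mul.
Qed.

Lemma cayley_graph_connected : generates_group S ->
  forall x y, reach e setT x y.
Proof.
move=> genS x y; rewrite -[x]mulg1 -[y](mulVKg x).
apply: (@reach_mul x setT) => //; set z := x^-1 * y.
have : subgroup_generated [set` S] z by rewrite genS.
move: z; apply: subgroup_generated_ind => [s sS||u v ru rv].
- apply: reach_step (reach_refl _ _) _ _ => //.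
  by rewrite /cayley_graph invg1 mul1g sS.
- exact: reach_refl.
- apply: reach_trans ru _; rewrite -[u in reach _ _ u](mulgVK v).
  rewrite -[u * _ in X in reach _ _ _ X]mulg1.
  exact: reach_mul (reach_sym cayley_graph_sym rv).
Qed.

End CayleyGraph.

(** * Left-invariant orderings and components *)

Section LeftOrder.
Variables (F : groupType) (S : {fset F}) (lt : rel F).
Hypotheses (genS : generates_group S) (ltP : left_invariant_ordering lt).
Local Notation e := (cayley_graph S).
Implicit Types (K D : set F) (L : seq F) (g h x y M : F).

Lemma ltxx x : lt x x = false.
Proof. by case: ltP => irr _ _ _; apply: irr. Qed.

Lemma lt_tr x y z : lt x y -> lt y z -> lt x z.
Proof. by case: ltP => _ tr _ _; apply: tr. Qed.

Lemma lt_mul g x y : lt (g * x) (g * y) = lt x y.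
Proof.
case: ltP => _ _ _ mul; apply/idP/idP; last exact: mul.
by move/(mul _ _ g^-1); rewrite !mulKg.
Qed.

Lemma lt_neq x y : ~~ lt y x -> x != y -> lt x y.
Proof. by case: ltP => _ _ tot _ /negPf nyx /tot; rewrite nyx orbF. Qed.

Lemma seq_upper_bound L : exists M, forall x, lt M x -> x \notin L.
Proof.
elim: L => [|y L [M ML]]; first by exists 1.
exists (if lt M y then y else M) => x; rewrite inE negb_or.
case: ifP => My lx.
  rewrite (ML _ (lt_tr My lx)) andbT; apply/eqP => xy.
  by rewrite xy ltxx in lx.
by rewrite (ML _ lx) andbT; apply/eqP => xy; rewrite -xy lx in My.
Qed.

(** This is where finite generation of the cone is used: monotone paths stay
    above M, up to excursions of bounded size between x and x * a that come from
    rewriting the cone generator a in terms of S. *)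
Lemma upper_set_connected (K : {fset F}) : fg_semigroup (positive_cone lt) ->
  exists M, forall x y, lt M x -> lt M y -> reach e (~` [set` K]) x y.
Proof.
move=> [A coneA].
have [t [t1 At tr]] :=
  connected_finite_superset A (cayley_graph_connected genS 1).
(* x * v in K means that x is one of the finitely many k * v^-1. *)
have [M ML] := seq_upper_bound [seq k * v^-1 | k <- K, v <- t].
have avoidK x v : lt M x -> v \in t -> x * v \notin K.
  move=> Mx vt; apply: contra (ML _ Mx) => xvK; apply/allpairsP.
  by exists (x * v, v); rewrite /= mulgK.
have up p : positive_cone lt p ->
    lt 1 p /\ forall x, lt M x -> reach e (~` [set` K]) x (x * p).
  rewrite coneA; move: p; apply: subsemigroup_generated_ind => [a aA|u v].
    split=> [|x Mx]; first by have : positive_cone lt a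
      by rewrite coneA; apply: sub_gen_smallest.
    rewrite -[X in reach _ _ X]mulg1; apply: reach_mul (tr _ (At _ aA)).
    by move=> v /= /(avoidK _ _ Mx) /negP.
  move=> [u1 ru] [v1 rv]; have above x w : lt 1 w -> lt x (x * w).
    by rewrite -{1}[x]mulg1 lt_mul.
  split=> [|x Mx]; first exact: lt_tr u1 (above u v v1).
  apply: reach_trans (ru x Mx) _; rewrite mulgA; apply: rv.
  exact: lt_tr Mx (above x u u1).
have mono x y : lt M x -> lt x y -> reach e (~` [set` K]) x y.
  move=> Mx xy; rewrite -[y](mulVKg x); apply: (proj2 (up _ _)) Mx.
  by rewrite /positive_cone /= -(lt_mul x) mulg1 mulVKg.
exists M => x y Mx My; have [xy|] := boolP (lt x y); first exact: mono.
have [->|xy nxy] := eqVneq x y.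
  by move=> _; apply: reach_refl; rewrite /= -[y]mulg1; apply/negP/avoidK.
apply: (reach_sym (cayley_graph_sym S)); apply: mono => //.
by apply: lt_neq; rewrite // eq_sym.
Qed.

(** A low infinite component D is contracted into itself by some g. The bound M
    need not lie in K; L links the two by a finite connected set, which g can
    move off itself. *)
Lemma attracting_translate K D L M (y0 : F) :
    component e K D -> infinite_set D ->
    (forall x, D x -> ~~ lt M x) -> ~ D y0 ->
    M \in L -> K `<=` [set` L] ->
    (forall x, x \in L -> reach e [set` L] M x) ->
  exists g, [/\ lt (g * M) M, D (g * M) & forall x, D x -> D (g * x)].
Proof.
move=> cD Dinf Dlow nDy0 ML KL Lconn.
(* This choice of d makes g * L disjoint from L. *)
have [d [Dd /negP dL]] := infinite_setN0 (infinite_setD Dinf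
  (finite_seq [seq x * y^-1 * M | x <- L, y <- L])).
pose g := d * M^-1.
have gM : g * M = d by rewrite mulgVK.
have gL y : y \in L -> g * y \notin L.
  move=> yL; apply: contra dL => gyL; apply/allpairsP.
  by exists (g * y, y); rewrite /= mulgK gM.
have DgL y : y \in L -> D (g * y).
  move=> yL; apply: (component_closed cD Dd); rewrite -gM.
  by apply: reach_mul (Lconn y yL) => z /= /gL /negP ngz /KL.
have DgM : D (g * M) by apply: DgL.
have gMlt : lt (g * M) M.
  apply: lt_neq; first exact: Dlow.
  by apply: contraNneq (gL _ ML) => ->.
(* If g x were in K, L would join it to M without meeting g K, and translating
   back by g^-1 would put g^-1 M > M into D. *)
have nKg x : D x -> ~ K (g * x).
  move=> Dx Kgx.
  have : D (g^-1 * M).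
    apply: (component_closed cD Dx); rewrite -[x](mulKg g).
    have /(reach_sym (cayley_graph_sym S)) := Lconn _ (KL _ Kgx).
    apply: reach_mul => z /= zL /KL /gL; rewrite mulVKg.
    by rewrite /= zL.
  by move/Dlow/negP; apply; rewrite -(lt_mul g) mulVKg.
exists g; split=> // x Dx.
(* A path from x that leaves D does so through a vertex v of K; the translated
   path ends next to g v, which is in D. *)
have [u [v [xu uv _ nDv]]] :=
  reach_exit (cayley_graph_connected genS x y0) Dx nDy0.
have Du := reach_target xu.
have Kv : K v by apply: contrapT => /(component_neighbor cD Du uv).
have Dgu : D (g * u).
  apply: (component_neighbor cD (DgL _ (KL _ Kv))); last exact: nKg.
  by rewrite cayley_graph_mul cayley_graph_sym.
apply: (component_closed cD Dgu).
exact: reach_mul nKg (reach_sym (cayley_graph_sym S) xu).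
Qed.

Lemma iter_attracting D g x n :
  (forall y, D y -> D (g * y)) -> D (g * x) -> D (g ^+ n.+1 * x).
Proof.
move=> gD Dgx; elim: n => [|n IH]; first by rewrite expg1.
by rewrite expgS -mulgA; apply: gD.
Qed.

Lemma iter_lt g M n : lt (g * M) M -> lt (g ^+ n.+1 * M) M.
Proof.
move=> gM; elim: n => [|n IH]; first by rewrite expg1.
by rewrite expgS -mulgA; apply: lt_tr gM; rewrite lt_mul.
Qed.

(** A path from M to y has finitely many vertices, and the powers of g are
    distinct, so some power carries the path off K; it then stays in D, where
    it starts. *)
Lemma iter_cofinal (K : {fset F}) D g M y :
    component e [set` K] D -> (forall x, D x -> ~~ lt M x) ->
    lt (g * M) M -> D (g * M) -> (forall x, D x -> D (g * x)) ->
  exists n, lt (g ^+ n * y) M.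
Proof.
move=> cD Dlow gMlt DgM gD.
have [V [yV _ VM]] := reach_finite (cayley_graph_connected genS M y).
have [n nV] : exists n, forall v, v \in V -> g ^+ n.+1 * v \notin K.
  apply: contrapT => noV.
  have bad n : g ^+ n \in 1 :: [seq k * v^-1 | k <- K, v <- V].
    case: n => [|n]; rewrite inE ?eqxx//; apply/orP; right.
    apply: contrapT => nin; apply: noV; exists n => v vV.
    apply/negP => gvK; apply: nin; apply/allpairsP.
    by exists (g ^+ n.+1 * v, v); rewrite /= mulgK.
  have [i [j [ij gij]]] := pigeonhole bad.
  have := iter_lt (j - i).-1 gMlt; rewrite prednK ?subn_gt0//.
  rewrite -(lt_mul (g ^+ i)) mulgA -expgnDr subnKC ?(ltnW ij)//.
  by rewrite -gij ltxx.
have DgnM := iter_attracting n gD DgM.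
have Dgny : D (g ^+ n.+1 * y).
  apply: (component_closed cD DgnM); apply: reach_mul (VM _ yV).
  by move=> v /= /nV /negP.
(* Being in D only bounds g^(n+1) y weakly by M; one more step by g makes the
   inequality strict. *)
exists n.+2; rewrite expgS -mulgA.
have [->//|ne] := eqVneq (g ^+ n.+1 * y) M.
by apply: lt_tr gMlt; rewrite lt_mul; apply: lt_neq ne; apply: Dlow.
Qed.

(** Both contractions push away from the same upper end, and finiteness of K
    then makes them share a power. *)
Lemma no_two_low_components (K : {fset F}) D1 D2 M :
    component e [set` K] D1 -> component e [set` K] D2 ->
    infinite_set D1 -> infinite_set D2 ->
    (forall x, D1 x -> ~ D2 x) ->
    (forall x, D1 x -> ~~ lt M x) -> (forall x, D2 x -> ~~ lt M x) ->
  False.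
Proof.
move=> c1 c2 inf1 inf2 D12 low1 low2.
have conn := cayley_graph_connected genS.
have [L [ML KL Lconn]] := connected_finite_superset K (conn M).
have [d1 D1d1] := infinite_setN0 inf1.
have [d2 D2d2] := infinite_setN0 inf2.
have nD1 : ~ D1 d2 by move=> /D12.
have [g [gM DgM gD]] := attracting_translate c1 inf1 low1 nD1 ML KL Lconn.
have [h [hM DhM hD]] :=
  attracting_translate c2 inf2 low2 (D12 _ D1d1) ML KL Lconn.
have [W [W1 _ WM]] := reach_finite (conn M (g^-1 * M)).
(* Otherwise the whole ray of translates g^-i W, shifted by h^(n+1), stays in
   D2, although it passes above every element. *)
have cross n : exists i,
    h ^+ n.+1 * (g ^+ i)^-1 \in [seq k * w^-1 | k <- K, w <- W].
  apply: contrapT => nocross.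
  have stay i : D2 (h ^+ n.+1 * (g ^+ i)^-1 * M).
    elim: i => [|i IH]; first by rewrite invg1 mulg1; apply: iter_attracting.
    apply: (component_closed c2 IH).
    rewrite (expgS g) invgM mulgA -[X in reach _ _ _ X]mulgA.
    apply: reach_mul (WM _ W1) => w /= wW wK; apply: nocross; exists i.
    apply/allpairsP; exists (h ^+ n.+1 * (g ^+ i)^-1 * w, w).
    by rewrite /= mulgK.
  have [i] := iter_cofinal ((h ^+ n.+1)^-1 * M) c1 low1 gM DgM gD.
  rewrite -(lt_mul (h ^+ n.+1 * (g ^+ i)^-1)) mulgA mulgVK mulVKg.
  exact/negP/low2/stay.
have [f fcross] := choice cross.
have [i [j [ij]]] := pigeonhole fcross.
have -> : j.+1 = (i.+1 + (j - i))%N by rewrite addSn subnKC // ltnW.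
rewrite expgnDr -mulgA => /mulgI; set m := (j - i).-1.
have -> : (j - i = m.+1)%N by rewrite prednK ?subn_gt0.
move: (f i) (f j) => a b; clearbody m => gh.
have {gh} gh : h ^+ m.+1 = (g ^+ a)^-1 * g ^+ b by rewrite gh mulgVK.
have [ba|ab] := leqP b a.
  have := iter_lt m hM; rewrite gh -{1}(subnKC ba) expgnDr invgM mulgVK.
  rewrite -(lt_mul (g ^+ (a - b))) mulVKg.
  case: (a - b)%N => [|c]; first by rewrite mul1g ltxx.
  by move/lt_tr/(_ (iter_lt c gM)); rewrite ltxx.
have := iter_attracting m hD DhM; rewrite gh -(subnKC ab).
rewrite addSnnS expgnDr mulKg => /(D12 _ _); apply.
exact: iter_attracting.
Qed.

End LeftOrder.

(** * Ends *)

Section Ends.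
Variables (V : choiceType) (e : rel V).
Hypothesis esym : symmetric e.

(** An end avoids every finite set: were its component off K equal to a finite
    set X, its component off K and X together would be a nonempty part of X
    that is disjoint from X. *)
Lemma end_component_infinite (E : {fset V} -> set V) K :
  graph_ends e E -> infinite_set (E K).
Proof.
move=> [compE cohE] /finite_fsetP[X EX].
have [x xL EL] := compE (K `|` X)%fset.
have : E K x.
  apply: (cohE K (K `|` X)%fset); first exact: fsubsetUl.
  by rewrite EL; apply/connected_offE/reach_refl/negP.
by rewrite EX /= => xX; move: xL; rewrite in_fsetU xX orbT.
Qed.

(** Components off the same set are equal or disjoint, so two ends that choose
    different components off K cannot share a vertex off any larger set. *)
Lemma ends_separated (E E' : {fset V} -> set V) :
    graph_ends e E -> graph_ends e E' -> E <> E' ->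
  exists K, forall L, (K `<=` L)%fset -> forall x, E L x -> ~ E' L x.
Proof.
move=> [compE cohE] [compE' cohE'] EE'.
apply: contrapT => nsep; apply: EE'; apply/funext => K.
apply: contrapT => EK; apply: nsep; exists K => L KL x Ex E'x; apply: EK.
apply: (component_eq (component_offP esym (compE K))
  (component_offP esym (compE' K)) (x := x)); [exact: cohE Ex|exact: cohE' E'x].
Qed.
End Ends.

Lemma infinite_set_three (T : Type) (A : set T) : infinite_set A ->
  exists x y z, [/\ A x, A y & A z] /\ [/\ x <> y, x <> z & y <> z].
Proof.
move=> infA; have [x Ax] := infinite_setN0 infA.
have [y [Ay yx]] := infinite_setN0 (infinite_setD infA (finite_set1 x)).
have [z [Az zxy]] := infinite_setN0 (infinite_setD infA (finite_set2 x y)).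
exists x, y, z; split=> //; split=> [xy|xz|yz]; [exact: yx| |].
- by apply: zxy; left.
- by apply: zxy; right.
Qed.

Theorem corollary2p4 (F : groupType) (S : {fset F})
    (genS : generates_group S)
    (infinitely_many_ends : infinite_set (graph_ends (cayley_graph S))) :
  ~ exists lt : rel F,
      left_invariant_ordering lt /\ fg_semigroup (positive_cone lt).
Proof.
move=> [lt [ltP fgP]].
have esym := cayley_graph_sym S.
have [E1 [E2 [E3 [[end1 end2 end3] [n12 n13 n23]]]]] :=
  infinite_set_three infinitely_many_ends.
have [K12 sep12] := ends_separated esym end1 end2 n12.
have [K13 sep13] := ends_separated esym end1 end3 n13.
have [K23 sep23] := ends_separated esym end2 end3 n23.
set K := (K12 `|` K13 `|` K23)%fset.
have [M upM] := upper_set_connected genS ltP K fgP.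
pose high (D : set F) := exists2 x, D x & lt M x.
(* Exactly one of any two separated ends is high, which three ends cannot
   satisfy. *)
have one_high E E' : graph_ends (cayley_graph S) E ->
    graph_ends (cayley_graph S) E' ->
    (forall x, E K x -> ~ E' K x) -> (high (E K) <-> ~ high (E' K)).
  move=> endE endE' disj.
  have c := component_offP esym (endE.1 K).
  have c' := component_offP esym (endE'.1 K).
  split=> [[x Ex Mx] [y E'y My]|low'].
    by apply: disj E'y; apply: (component_closed c Ex (upM _ _ Mx My)).
  apply: contrapT => low.
  have lowP D : ~ high D -> forall x, D x -> ~~ lt M x.
    by move=> nD x Dx; apply/negP => Mx; apply: nD; exists x.
  exact: (no_two_low_components genS ltP c c'
    (@end_component_infinite _ _ _ K endE)
    (@end_component_infinite _ _ _ K endE') disj (lowP _ low) (lowP _ low')).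
have K12K : (K12 `<=` K)%fset by rewrite /K -fsetUA fsubsetUl.
have K13K : (K13 `<=` K)%fset by rewrite /K fsetUAC fsubsetUr.
have K23K : (K23 `<=` K)%fset by rewrite fsubsetUr.
have := one_high _ _ end1 end2 (sep12 _ K12K).
have := one_high _ _ end1 end3 (sep13 _ K13K).
have := one_high _ _ end2 end3 (sep23 _ K23K).
tauto.
Qed.
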